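(* For every instance, every allocation selected by Generalized PAV satisfies EJR-1.
   Context: Model: There is a set of agents $N=\{1,\dots,n\}$. The resource $R$ consists of a cake $C=[0,c]$ for a real $c\ge 0$ and a set of indivisible goods $G=\{g_1,\dots,g_m\}$ for an integer $m\ge 0$, with $\max(c,m)>0$. A piece of cake is a union of finitely many disjoint closed subintervals of $C$; its length $\ell(\cdot)$ is the sum of the lengths of its intervals. A bundle $R'=(C',G')$ consists of a piece of cake $C'\subseteq C$ and a set $G'\subseteq G$; its size is $s(R')=\ell(C')+|G'|$. Each agent $i$ approves a bundle $R_i=(C_i,G_i)$, and her utility for a bundle $R'$ is $u_i(R')=\ell(C_i\cap C')+|G_i\cap G'|$. A parameter $\alpha\in(0,c+m]$ is given; an allocation is a bundle $A$ with $s(A)\le\alpha$. For a real $t>0$, $N^*\subseteq N$ is $t$-cohesive if $|N^*|\ge t n/\alpha$ and $s(\bigcap_{i\in N^*}R_i)\ge t$. EJR-1: an allocation $A$ satisfies EJR-1 if for every real $t>0$ and every $t$-cohesive group $N^*$, some $j\in N^*$ has $u_j(A)>t-1$. Generalized harmonic numbers: $H_x\coloneqq\sum_{k=1}^\infty\frac{x}{k(x+k)}$ for real $x\ge0$. Generalized PAV selects an allocation $R'$ with $s(R')\le\alpha$ maximizing $\sum_{i\in N}H_{u_i(R')}$. *)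

(* Defs.v *)
From HB Require Import structures.
From mathcomp Require Import all_boot all_order all_algebra.
From mathcomp Require Import all_classical all_reals all_analysis.
Set Implicit Arguments. Unset Strict Implicit. Unset Printing Implicit Defensive.
Import Order.TTheory GRing.Theory Num.Theory.
Local Open Scope classical_set_scope.
Local Open Scope ring_scope.

Section CakeGoods.
Variable R : realType.

Definition is_piece (c : R) (S : set R) : Prop :=
  exists (k : nat) (I : 'I_k -> R * R),
    (forall i, 0 <= (I i).1 /\ (I i).1 <= (I i).2 /\ (I i).2 <= c) /\
    (forall i j, i != j ->
       [set x | (I i).1 <= x <= (I i).2] `&` [set x | (I j).1 <= x <= (I j).2]
       = set0) /\
    S = \bigcup_(i in [set: 'I_k]) [set x | (I i).1 <= x <= (I i).2].

Definition len (S : set R) : R := fine (@lebesgue_measure R S).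

(* a bundle: a piece of cake and a set of goods *)
Definition bundle (m : nat) := (set R * {set 'I_m})%type.

Definition is_bundle (c : R) (m : nat) (B : bundle m) : Prop := is_piece c B.1.

Definition bsize (m : nat) (B : bundle m) : R := len B.1 + #|B.2|%:R.

(* utility of an agent approving Ri for the bundle B *)
Definition util (m : nat) (Ri B : bundle m) : R :=
  len (Ri.1 `&` B.1) + #|Ri.2 :&: B.2|%:R.

Definition is_allocation (c : R) (m : nat) (alpha : R) (B : bundle m) : Prop :=
  is_bundle c B /\ bsize B <= alpha.

Definition group_inter (n m : nat) (RA : 'I_n -> bundle m) (Ns : {set 'I_n})
  : bundle m :=
  (\bigcap_(i in [set j | j \in Ns]) (RA i).1, \big[@finset.setI _/finset.setTfor _]_(i in Ns) (RA i).2).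

Definition cohesive (n m : nat) (alpha : R) (RA : 'I_n -> bundle m)
  (t : R) (Ns : {set 'I_n}) : Prop :=
  t * n%:R / alpha <= #|Ns|%:R /\ t <= bsize (group_inter RA Ns).

Definition EJR1 (n m : nat) (alpha : R) (RA : 'I_n -> bundle m) (A : bundle m)
  : Prop :=
  forall (t : R), 0 < t -> forall Ns : {set 'I_n}, cohesive alpha RA t Ns ->
    exists2 j, j \in Ns & t - 1 < util (RA j) A.

Definition genH (x : R) : R :=
  limn (fun N : nat => \sum_(1 <= k < N) (x / (k%:R * (x + k%:R)))).

Definition gpav_score (n m : nat) (RA : 'I_n -> bundle m) (B : bundle m) : R :=
  \sum_(i < n) genH (util (RA i) B).

Definition is_GPAV (c : R) (n m : nat) (alpha : R) (RA : 'I_n -> bundle m)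
  (A : bundle m) : Prop :=
  is_allocation c alpha A /\
  forall B : bundle m, is_allocation c alpha B -> gpav_score RA B <= gpav_score RA A.

End CakeGoods.

(* Main.v *)
Require Import Defs.
From HB Require Import structures.
From mathcomp Require Import all_boot all_order all_algebra.
From mathcomp Require Import all_classical all_reals all_analysis.
From mathcomp Require Import ring lra.
Set Implicit Arguments. Unset Strict Implicit. Unset Printing Implicit Defensive.
Import Order.TTheory GRing.Theory Num.Theory.
Import numFieldNormedType.Exports.
Local Open Scope classical_set_scope.
Local Open Scope ring_scope.

(** Suppose a t-cohesive group Ns has all its utilities at most t - 1 under a
    GPAV allocation A. The resource common to Ns has size at least t, so one
    further unit of it (a single good, or an amount 1 of cake) can be added to
    A. Since H_{u+1} - H_u = 1/(u+1), the score grows by at least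
    |Ns|/t >= n/alpha. If alpha is now exceeded, at most one unit has to be
    removed; removing p <= 1 units of the utility u costs at most p/u, so the
    marginal costs of everything in the enlarged bundle add up to at most n.
    As its size exceeds alpha, either some good or a uniform proportion of the
    cake can be removed at a cost below n/alpha, contradicting optimality.

    The interval endpoints of all the pieces involved cut the cake into cells
    on whose interiors each approval set is constant, so only the fraction of each cell
    contained in a bundle matters. *)

(** * Generalized harmonic numbers: convergence and increments *)

Section GeneralizedHarmonic.
Context {R : realType}.
Implicit Types (u v x p : R) (N : nat).

Definition genH_partial x N : R := \sum_(1 <= k < N) (x / (k%:R * (x + k%:R))).

Lemma genH_partialS x N : genH_partial x N.+2 =
  genH_partial x N.+1 + x / (N.+1%:R * (x + N.+1%:R)).
Proof. by rewrite /genH_partial big_nat_recr. Qed.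

Lemma genH_partial1 x : genH_partial x 1 = 0.
Proof. by rewrite /genH_partial big_geq. Qed.

(** For [k >= 1] each term is at most [2 * x / (k * (k + 1))], and these bounds telescope. The
    partial sums are therefore bounded, which gives convergence. *)
Lemma genH_partial_le x N : 0 <= x ->
  genH_partial x N.+1 <= 2 * x * (1 - N.+1%:R^-1).
Proof.
move=> x0; elim: N => [|N IH]; first by rewrite genH_partial1 invr1 subrr mulr0.
rewrite genH_partialS (le_trans (lerD IH (lexx _)))//.
have N0 : 0 < N.+1%:R :> R by rewrite ltr0n.
rewrite -(natr1 N.+1); move: (N.+1%:R) N0 (ler1n R N.+1) => y y0 y1.
have h : x / (y * (x + y)) <= x * (2 / (y * (y + 1))).
  rewrite ler_wpM2l// -[2 / _]invf_div lef_pV2 ?posrE ?divr_gt0 ?mulr_gt0//; last 2 first.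
  - lra.
  - lra.
  have xy0 : 0 <= x * y by rewrite mulr_ge0// ltW.
  have yy0 : 0 <= y * (y - 1) by rewrite mulr_ge0 ?subr_ge0// ltW.
  rewrite ler_pdivrMr//; lra.
have -> : 2 * x * (1 - (y + 1)^-1) = 2 * x * (1 - y^-1) + x * (2 / (y * (y + 1))).
  by field; rewrite !gt_eqF//; lra.
by rewrite lerD2l.
Qed.

Lemma is_cvg_genH x : 0 <= x -> cvgn (genH_partial x).
Proof.
move=> x0; apply: (@nondecreasing_is_cvgn _ (genH_partial x)).
  apply/nondecreasing_seqP => -[|N].
    by rewrite genH_partial1 /genH_partial big_geq.
  by rewrite genH_partialS lerDl divr_ge0// mulr_ge0// addr_ge0.
exists (2 * x) => _ [[|N] _ <-].
  by rewrite /genH_partial big_geq// mulr_ge0.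
rewrite (le_trans (genH_partial_le N x0))// ler_piMr ?mulr_ge0//.
Qed.

Lemma genHE x : genH x = limn (genH_partial x).
Proof. by []. Qed.

Lemma cvg_genH x : 0 <= x -> genH_partial x N.+1 @[N --> \oo] --> genH x.
Proof. by move=> x0; rewrite (cvg_shiftS (genH_partial x)); exact: is_cvg_genH. Qed.

Lemma le_genH u v : 0 <= u -> u <= v -> genH u <= genH v.
Proof.
move=> u0 uv; rewrite !genHE; apply: ler_lim.
- exact: is_cvg_genH.
- by apply: is_cvg_genH; exact: le_trans uv.
apply: nearW => N; apply: ler_sum_nat => k /andP[k1 _].
have k0 : 0 < k%:R :> R by rewrite ltr0n.
rewrite ler_pdivrMr ?mulr_gt0 ?ltr_wpDl// mulrAC ler_pdivlMr; first by nra.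
by rewrite mulr_gt0// ltr_wpDl//; lra.
Qed.

(** As [x / (k * (x + k)) = 1 / k - 1 / (x + k)], the terms differ by
    [1 / (u + k) - 1 / (u + 1 + k)], which telescopes. *)
Lemma genH_partial_add1 u N : 0 <= u ->
  genH_partial (u + 1) N.+1 - genH_partial u N.+1 =
  (u + 1)^-1 - (u + N.+1%:R)^-1.
Proof.
move=> u0; elim: N => [|N IH]; first by rewrite !genH_partial1 !subrr.
rewrite !genH_partialS opprD addrACA IH -(natr1 N.+1).
move: (N.+1%:R) (ltr0Sn R N) => y y0; field; rewrite !gt_eqF//; lra.
Qed.

Lemma genH_add1 u : 0 <= u -> genH (u + 1) = genH u + (u + 1)^-1.
Proof.
move=> u0.
have cu := cvg_genH (addr_ge0 u0 ler01).
have cv := cvg_genH u0.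
have ch : ((u + n.+1%:R)^-1 : R) @[n --> \oo] --> (0 : R).
  apply: (@squeeze_cvgr _ _ _ _ (fun=> 0) (@harmonic R)).
  - apply: nearW => n; rewrite invr_ge0 addr_ge0//= /harmonic.
    by rewrite lef_pV2 ?posrE ?lerDr// ltr_wpDl.
  - exact: cvg_cst.
  - exact: cvg_harmonic.
have cw := cvgD cv (cvgB (@cvg_cst _ (u + 1)^-1 _ _ _) ch).
rewrite subr0 in cw; apply: (cvg_unique _ cu) => //.
rewrite (_ : (fun N : nat => genH_partial (u + 1) N.+1) =
    (fun N : nat => genH_partial u N.+1 + ((u + 1)^-1 - (u + N.+1%:R)^-1))).
  exact: cw.
by apply/funext => N; rewrite -genH_partial_add1// addrCA subrr addr0.
Qed.

(** The terms differ by [p / ((u + k) * (u - p + k))]. Since [p <= 1], the second factor is at least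
    [u + k - 1], and the resulting bounds telescope. *)
Lemma genH_partial_sub u p N : 0 <= p -> p <= 1 -> p <= u -> 0 < u ->
  genH_partial u N.+1 - genH_partial (u - p) N.+1 <= p / u - p / (u + N%:R).
Proof.
move=> p0 p1 pu u0; elim: N => [|N IH].
  by rewrite !genH_partial1 addr0 !subrr.
rewrite !genH_partialS opprD addrACA (le_trans (lerD IH (lexx _)))// -(natr1 N).
move: (N%:R) (ler0n R N) => y y0.
have -> : u / ((y + 1) * (u + (y + 1))) - (u - p) / ((y + 1) * (u - p + (y + 1)))
    = p / ((u + (y + 1)) * (u - p + (y + 1))).
  by field; rewrite !gt_eqF//; lra.
have h : p / ((u + (y + 1)) * (u - p + (y + 1))) <= p / ((u + (y + 1)) * (u + y)).
  by rewrite ler_wpM2l// lef_pV2 ?posrE ?mulr_gt0//; nra.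
have -> : p / u - p / (u + (y + 1)) =
    p / u - p / (u + y) + p / ((u + (y + 1)) * (u + y)).
  by field; rewrite !gt_eqF//; lra.
by rewrite lerD2l.
Qed.

(* For u = 0 the bound is the junk value p / 0 = 0, which is correct since then p = 0. *)
Lemma genH_sub u p : 0 <= p -> p <= 1 -> p <= u ->
  genH u - p / u <= genH (u - p).
Proof.
move=> p0 p1 pu; have [u0|u0] := leP u 0.
  have -> : p = 0 by lra.
  by rewrite mul0r !subr0.
rewrite lerBlDr.
have cu := cvg_genH (ltW u0).
have cv : genH_partial (u - p) N.+1 @[N --> \oo] --> genH (u - p).
  by apply: cvg_genH; rewrite subr_ge0.
apply: (ler_cvg_to cu (cvgD cv (@cvg_cst _ (p / u) _ _ _))).
apply: nearW => N /=; rewrite -lerBlDl (le_trans (genH_partial_sub N p0 p1 pu u0))//.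
by rewrite gerBl divr_ge0// addr_ge0// ltW.
Qed.
End GeneralizedHarmonic.

(** * Fractional bundles over cells: sizes, utilities and removal costs *)

Section FractionalBundles.
Context {R : realType} {n m K : nat}.
(* The cell k has length d k; chi i k says that agent i approves it, and phi k is
   the fraction of it that is allocated. *)
Variables (d : 'I_K -> R) (chi : 'I_n -> pred 'I_K) (G : 'I_n -> {set 'I_m}).
Hypothesis d_ge0 : forall k, 0 <= d k.
Implicit Types (phi : 'I_K -> R) (S : {set 'I_m}) (i : 'I_n).

Definition cake_size phi : R := \sum_k phi k * d k.
Definition cake_util phi i : R := \sum_(k | chi i k) phi k * d k.
Definition frac_size phi S : R := cake_size phi + #|S|%:R.
Definition frac_util phi S i : R := cake_util phi i + #|G i :&: S|%:R.
Definition frac_score phi S : R := \sum_(i < n) genH (frac_util phi S i).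

Lemma cake_size_ge0 phi : (forall k, 0 <= phi k) -> 0 <= cake_size phi.
Proof. by move=> h; apply: sumr_ge0 => k _; rewrite mulr_ge0. Qed.

Lemma cake_util_ge0 phi i : (forall k, 0 <= phi k) -> 0 <= cake_util phi i.
Proof. by move=> h; apply: sumr_ge0 => k _; rewrite mulr_ge0. Qed.

Lemma cake_util_le_size phi i : (forall k, 0 <= phi k) ->
  cake_util phi i <= cake_size phi.
Proof.
move=> h; rewrite /cake_util big_mkcond; apply: ler_sum => k _.
by case: ifP => // _; rewrite mulr_ge0.
Qed.

Lemma frac_util_ge0 phi S i : (forall k, 0 <= phi k) -> 0 <= frac_util phi S i.
Proof. by move=> h; rewrite addr_ge0 ?cake_util_ge0. Qed.

Lemma cake_size_scale a phi : cake_size (fun k => a * phi k) = a * cake_size phi.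
Proof. by rewrite /cake_size mulr_sumr; apply: eq_bigr => k _; rewrite mulrA. Qed.

Lemma cake_util_scale a phi i :
  cake_util (fun k => a * phi k) i = a * cake_util phi i.
Proof. by rewrite /cake_util mulr_sumr; apply: eq_bigr => k _; rewrite mulrA. Qed.

(** An agent loses [rho] times her cake utility. This is at most [rho * cake_size phi <= 1], so
    [genH_sub] bounds the loss of each agent. *)
Lemma shrink_score rho phi S : (forall k, 0 <= phi k) ->
  0 <= rho -> rho <= 1 -> rho * cake_size phi <= 1 ->
  frac_score phi S - rho * (\sum_(i < n) cake_util phi i / frac_util phi S i)
    <= frac_score (fun k => (1 - rho) * phi k) S.
Proof.
move=> phi0 rho0 rho1 rhoL; rewrite mulr_sumr -sumrB; apply: ler_sum => i _.
have c0 := cake_util_ge0 i phi0; have cL := cake_util_le_size i phi0.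
have -> : frac_util (fun k => (1 - rho) * phi k) S i =
    frac_util phi S i - rho * cake_util phi i.
  by rewrite /frac_util cake_util_scale; ring.
rewrite mulrA; apply: genH_sub.
- exact: mulr_ge0.
- by rewrite (le_trans _ rhoL)// ler_wpM2l.
- rewrite /frac_util (@le_trans _ _ (cake_util phi i))//.
    by rewrite ler_piMl.
  by rewrite lerDl.
Qed.

Lemma remove_good_score g phi S : (forall k, 0 <= phi k) -> g \in S ->
  frac_score phi S - \sum_(i < n) (g \in G i)%:R / frac_util phi S i
    <= frac_score phi (S :\ g).
Proof.
move=> phi0 gS; rewrite -sumrB; apply: ler_sum => i _.
have E : #|G i :&: S| = ((g \in G i) + #|G i :&: (S :\ g)|)%N.
  by rewrite finset.setIDA (cardsD1 g (G i :&: S)) inE gS andbT.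
have -> : frac_util phi (S :\ g) i = frac_util phi S i - (g \in G i)%:R.
  by rewrite /frac_util E natrD; ring.
apply: genH_sub; rewrite ?ler0n ?lern1 ?leq_b1//.
by rewrite /frac_util E natrD addrCA lerDl addr_ge0// cake_util_ge0.
Qed.

(** After exchanging the sums, each agent contributes her utility divided by itself: 1, or 0 if the
    utility is zero. This is the budget that bounds all removal costs together. *)
Lemma sum_cake_share_le phi S : (forall k, 0 <= phi k) ->
  \sum_(i < n) cake_util phi i / frac_util phi S i +
  \sum_(g in S) \sum_(i < n) (g \in G i)%:R / frac_util phi S i <= n%:R.
Proof.
move=> phi0; rewrite exchange_big/= -big_split/=.
rewrite -[leRHS]mulr1 -[n in leRHS]card_ord mulr_natl -sumr_const.
apply: ler_sum => i _; rewrite -mulr_suml -mulrDl -natr_sum.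
have -> : (\sum_(g in S) (g \in G i) = #|G i :&: S|)%N.
  rewrite -sum1_card [RHS](eq_bigl (fun g => (g \in S) && (g \in G i))).
    by rewrite [RHS]big_mkcondr/=; apply: eq_bigr => g _; case: ifP.
  by move=> g; rewrite inE andbC.
rewrite -/(frac_util phi S i).
have [->|u0] := eqVneq (frac_util phi S i) 0; first by rewrite mul0r.
by rewrite divff.
Qed.

(** * Optimality over fractional bundles, also under an overflow *)

Section Optimality.
Variables (alpha M : R).
Hypothesis alpha_gt0 : 0 < alpha.

(** Fractions below 1 are the ones realized by pieces of cake. Scaling by [1 - rho] with a small
    [rho > 0] leads back to them, at a loss of at most [rho * n], which is arbitrarily small. *)
Lemma optimal_closed :
  (forall phi S, (forall k, 0 <= phi k < 1) -> frac_size phi S <= alpha ->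
     frac_score phi S <= M) ->
  forall phi S, (forall k, 0 <= phi k <= 1) -> frac_size phi S <= alpha ->
     frac_score phi S <= M.
Proof.
move=> opt phi S phi01 Sle.
have phi0 k : 0 <= phi k by case/andP: (phi01 k).
suff main (e : R) : 0 < e -> frac_score phi S <= M + e by apply/ler_addgt0Pr.
move=> e0.
(* With [rho = 1 / y], the three summands ensure in turn [rho <= 1], [rho * cake_size phi <= 1] and
   [rho * n <= e]. *)
have [y yE] : exists y : R, y = 1 + alpha + n%:R / e by eexists.
have y_gt : 1 + alpha <= y by rewrite yE lerDl divr_ge0// ltW.
pose rho := y^-1.
have y0 : 0 < y by rewrite (lt_le_trans _ y_gt)// addr_gt0.
have L0 := cake_size_ge0 phi0.
have Lle : cake_size phi <= alpha by rewrite (le_trans _ Sle)// lerDl.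
have rho0 : 0 < rho by rewrite invr_gt0.
have rho1 : rho <= 1 by rewrite invf_le1//; lra.
have := @shrink_score rho phi S phi0 (ltW rho0) rho1.
have -> : rho * cake_size phi <= 1.
  by rewrite mulrC ler_pdivrMr// mul1r; lra.
move=> /(_ isT) h.
have {}h := le_trans h (opt _ _ _ _).
rewrite -lerBlDr (le_trans _ (h _ _))//.
- rewrite lerD2l lerN2 (@le_trans _ _ (rho * n%:R))//.
    rewrite ler_wpM2l ?(ltW rho0)// (le_trans _ (sum_cake_share_le S phi0))// lerDl.
    apply: sumr_ge0 => g _; apply: sumr_ge0 => i _.
    by rewrite divr_ge0// frac_util_ge0.
  rewrite mulrC ler_pdivrMr//.
  have -> : e * y = n%:R + e * (1 + alpha) by rewrite yE; field; rewrite gt_eqF.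
  by rewrite lerDl mulr_ge0//; lra.
- move=> k; have /andP[a b] := phi01 k.
  by rewrite mulr_ge0 ?subr_ge0//=; nra.
- rewrite (le_trans _ Sle)// lerD2r cake_size_scale ler_piMl//.
  by rewrite gerBl ltW.
Qed.

Hypothesis n_gt0 : (0 < n)%N.
Hypothesis opt : forall phi S, (forall k, 0 <= phi k <= 1) ->
  frac_size phi S <= alpha -> frac_score phi S <= M.

(* Undo an overflow of one unit: if deleting a single good is never cheap, the
   goods carry so much of the total loss n that shrinking the cake is cheap. *)
Lemma overfull_score phi S : (forall k, 0 <= phi k <= 1) ->
  frac_size phi S <= alpha + 1 -> frac_score phi S < M + n%:R / alpha.
Proof.
move=> phi01 Zle.
have phi0 k : 0 <= phi k by case/andP: (phi01 k).
have n0 : 0 < n%:R :> R by rewrite ltr0n.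
have na0 : 0 < n%:R / alpha by rewrite divr_gt0.
have [Zal|Zal] := leP (frac_size phi S) alpha.
  by rewrite (le_lt_trans (opt phi01 Zal))// ltrDl.
set u := frac_util phi S.
have [[g gS gcheap]|expensive] := pselect (exists2 g, g \in S &
    \sum_(i < n) (g \in G i)%:R / u i < n%:R / alpha).
  have := remove_good_score phi0 gS; rewrite -/u.
  have /(opt phi01) : frac_size phi (S :\ g) <= alpha.
    move: Zle; rewrite /frac_size (cardsD1 g S) gS natrD/=; lra.
  lra.
have lG : #|S|%:R * (n%:R / alpha) <=
    \sum_(g in S) \sum_(i < n) (g \in G i)%:R / u i.
  rewrite mulr_natl -sumr_const; apply: ler_sum => g gS.
  by rewrite leNgt; apply/negP => h; apply: expensive; exists g.
have tot := sum_cake_share_le S phi0; rewrite -/u in tot.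
set lC := \sum_(i < n) cake_util phi i / u i in tot.
have lC0 : 0 <= lC.
  by apply: sumr_ge0 => i _; rewrite divr_ge0 ?cake_util_ge0 ?frac_util_ge0.
set q := #|S|%:R : R in lG Zle Zal *.
set L := cake_size phi in Zle Zal *.
(* Of the total budget [n], the goods take at least [q * n / alpha]; the cake gets the rest. As
   [lC >= 0], this also forces [q <= alpha], so the overfull bundle contains cake. *)
have lCle : lC <= n%:R / alpha * (alpha - q).
  have -> : n%:R / alpha * (alpha - q) = n%:R - q * (n%:R / alpha).
    by field; rewrite gt_eqF.
  lra.
have qle : q <= alpha.
  by rewrite -subr_ge0 -(pmulr_rge0 _ na0) (le_trans lC0).
have [Zle' Zal'] : L + q <= alpha + 1 /\ alpha < L + q by [].
(* This proportion of the cake is exactly the overflow, which is at most 1. *)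
pose rho := (L + q - alpha) / L.
have L0 : 0 < L by lra.
have rho0 : 0 <= rho by rewrite divr_ge0//; lra.
have rho1 : rho <= 1 by rewrite ler_pdivrMr//; lra.
have rhoL : rho * L = L + q - alpha by rewrite divfK// gt_eqF.
have := @shrink_score rho phi S phi0 rho0 rho1.
rewrite -/L rhoL -/u -/lC => sh.
have {}sh := sh ltac:(lra).
have sc : frac_score (fun k => (1 - rho) * phi k) S <= M.
  apply: opt.
    move=> k; have /andP[a b] := phi01 k; apply/andP; split; nra.
  rewrite /frac_size cake_size_scale -/L -/q; lra.
suff : rho * lC < n%:R / alpha by lra.
(* With [e] the overflow, [alpha - q = L - e], so the claim becomes [e * (L - e) < L]. It holds
   because [0 < e <= 1] and [L - e >= 0]. *)
rewrite (le_lt_trans (ler_wpM2l rho0 lCle))// mulrCA gtr_pMr//.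
rewrite /rho mulrAC ltr_pdivrMr// mul1r; nra.
Qed.

End Optimality.

(** * Gain from one more unit of the common resource *)

Lemma frac_util_le phi phi' S S' i : (forall k, phi k <= phi' k) ->
  S \subset S' -> frac_util phi S i <= frac_util phi' S' i.
Proof.
move=> h SS; rewrite lerD//; first by apply: ler_sum => k _; rewrite ler_wpM2r.
by rewrite ler_nat subset_leq_card// finset.setIS.
Qed.

(** By [genH_add1] each member of [Ns] gains [1 / (u + 1) >= 1 / b]; by monotonicity no other agent
    loses. *)
Lemma frac_score_gain phi phi' S S' (Ns : {set 'I_n}) (b : R) :
  (forall k, 0 <= phi k) ->
  (forall k, phi k <= phi' k) -> S \subset S' ->
  (forall i, i \in Ns -> frac_util phi' S' i = frac_util phi S i + 1) ->
  (forall i, i \in Ns -> frac_util phi S i + 1 <= b) ->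
  frac_score phi S + #|Ns|%:R / b <= frac_score phi' S'.
Proof.
move=> phi0 pp SS e ub.
have -> : #|Ns|%:R / b = \sum_(i < n) (if i \in Ns then b^-1 else 0).
  by rewrite -big_mkcond/= sumr_const mulr_natl.
rewrite -big_split/=; apply: ler_sum => i _.
have u0 := frac_util_ge0 S i phi0.
case: ifPn => iN; last by rewrite addr0 le_genH ?frac_util_le.
rewrite e// genH_add1// lerD2l; have := ub i iN => h.
by rewrite lef_pV2// posrE; lra.
Qed.

(** A common good outside [S] can simply be added. If there is none, the common cake not yet
    allocated has length at least 1, and a uniform proportion of it supplies the unit. *)
Lemma unit_of_common_resource (a : pred 'I_K) S (tau : pred 'I_K) (GT : {set 'I_m})
    (Ns : {set 'I_n}) (t : R) :
  Ns != finset.set0 ->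
  (forall i k, i \in Ns -> tau k -> chi i k) ->
  (forall i, i \in Ns -> GT \subset G i) ->
  t <= frac_size (fun k => (tau k)%:R) GT ->
  (forall i, i \in Ns -> frac_util (fun k => (a k)%:R) S i <= t - 1) ->
  exists phi' S', [/\ forall k, 0 <= phi' k <= 1,
    forall k, (a k)%:R <= phi' k, S \subset S',
    frac_size phi' S' = frac_size (fun k => (a k)%:R) S + 1 &
    forall i, i \in Ns ->
      frac_util phi' S' i = frac_util (fun k => (a k)%:R) S i + 1].
Proof.
move=> Ns0 tauchi GTG tle ule.
have [/subsetPn[g gT gS]|] := boolP (~~ (GT \subset S)).
  exists (fun k => (a k)%:R), (g |: S); split => //.
  - by move=> k; rewrite ler0n lern1 leq_b1.
  - exact: finset.subsetUr.
  - by rewrite /frac_size cardsU1 gS natrD/=; ring.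
  - move=> i iN; rewrite /frac_util finset.setIUr.
    have -> : G i :&: [set g] = [set g]%SET.
      by apply/finset.setIidPr; rewrite finset.sub1set (fintype.subsetP (GTG i iN)).
    rewrite cardsU1 inE (negbTE gS) andbF natrD/=; ring.
rewrite negbK => GTS.
pose f k := (tau k && ~~ a k)%:R : R.
have f0 k : 0 <= f k by [].
pose L := cake_size f.
(* Any member already enjoys all of [GT] and the common cake inside [a]. That is at least [t - L],
   while her utility is at most [t - 1]. *)
have L1 : 1 <= L.
  have /set0Pn[j jN] := Ns0.
  have := ule j jN; rewrite /frac_util.
  have : #|GT|%:R <= #|G j :&: S|%:R :> R.
    by rewrite ler_nat subset_leq_card// finset.subsetI GTG.
  move: tle; rewrite /frac_size.
  suff : cake_size (fun k => (tau k)%:R) <= L + cake_util (fun k => (a k)%:R) j by lra.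
  rewrite /L /cake_size /cake_util [X in _ <= _ + X]big_mkcond/= -big_split/=.
  apply: ler_sum => k _; rewrite /f.
  have := tauchi j k jN; have := d_ge0 k.
  case: (tau k); case: (a k); case: (chi j k) => //= dk hk;
    rewrite ?mul0r ?mul1r ?addr0 ?add0r//.
  by have := hk isT.
(* The support of [psi] avoids [a], and [L >= 1], so adding [psi] to [a] keeps all fractions at most
   1. *)
pose psi k := L^-1 * f k.
have L0 : 0 < L by lra.
have invL : L^-1 <= 1 by rewrite invf_le1.
have iL0 : 0 <= L^-1 by rewrite invr_ge0 ltW.
have psi0 k : 0 <= psi k by rewrite mulr_ge0.
have psi1 : cake_size psi = 1 by rewrite cake_size_scale mulVf// gt_eqF.
have psiu i : i \in Ns -> cake_util psi i = 1.
  move=> iN; rewrite -[RHS]psi1 /cake_util big_mkcond/=; apply: eq_bigr => k _.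
  have := tauchi i k iN; rewrite /psi /f.
  case: (tau k); case: (chi i k) => //= hk; rewrite ?mulr0 ?mul0r//.
  by have := hk isT.
exists (fun k => (a k)%:R + psi k), S; split => //.
- move=> k; rewrite addr_ge0//= /psi /f.
  by case: (a k); rewrite /= ?andbF ?andbT ?mulr0 ?addr0// add0r;
    case: (tau k); rewrite /= ?mulr1 ?mulr0.
- by move=> k; rewrite lerDl.
- rewrite /frac_size -psi1 addrAC; congr (_ + _).
  by rewrite /cake_size -big_split/=; apply: eq_bigr => k _; rewrite mulrDl.
- move=> i iN; rewrite /frac_util -(psiu i iN) addrAC; congr (_ + _).
  by rewrite /cake_util -big_split/=; apply: eq_bigr => k _; rewrite mulrDl.
Qed.

Lemma frac_EJR1 (alpha t : R) (a : pred 'I_K) S (tau : pred 'I_K) (GT : {set 'I_m})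
    (Ns : {set 'I_n}) :
  (0 < n)%N -> 0 < alpha -> 0 < t ->
  frac_size (fun k => (a k)%:R) S <= alpha ->
  (forall phi S', (forall k, 0 <= phi k < 1) -> frac_size phi S' <= alpha ->
     frac_score phi S' <= frac_score (fun k => (a k)%:R) S) ->
  (forall i k, i \in Ns -> tau k -> chi i k) ->
  (forall i, i \in Ns -> GT \subset G i) ->
  t * n%:R / alpha <= #|Ns|%:R ->
  t <= frac_size (fun k => (tau k)%:R) GT ->
  exists2 j, j \in Ns & t - 1 < frac_util (fun k => (a k)%:R) S j.
Proof.
move=> n0 al0 t0 Sle opt tauchi GTG coh tle; apply: contrapT => noj.
have ule i : i \in Ns -> frac_util (fun k => (a k)%:R) S i <= t - 1.
  by move=> iN; rewrite leNgt; apply/negP => h; apply: noj; exists i.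
have Ns0 : Ns != finset.set0.
  rewrite -card_gt0 -(ltr0n R) (lt_le_trans _ coh)// divr_gt0// mulr_gt0//.
  by rewrite ltr0n.
have [phi' [S' [phi01 le_phi SS' size' util']]] :=
  unit_of_common_resource Ns0 tauchi GTG tle ule.
have a0 k : 0 <= (a k)%:R :> R by [].
have ub i : i \in Ns -> frac_util (fun k => (a k)%:R) S i + 1 <= t.
  by move=> /ule; lra.
have gain := frac_score_gain a0 le_phi SS' util' ub.
(* The strict bound at size [alpha + 1] contradicts [gain], as cohesiveness gives
   [#|Ns| / t >= n / alpha]. *)
have := @overfull_score _ _ al0 n0 (optimal_closed al0 opt) phi' S' phi01.
rewrite size' lerD2r => /(_ Sle).
have : n%:R / alpha <= #|Ns|%:R / t by rewrite ler_pdivlMr// mulrC mulrA.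
lra.
Qed.

End FractionalBundles.

(** * Length of pieces of cake, and cutting the cake at endpoints *)

Section Length.
Context {R : realType}.
Implicit Types (S E F : set R) (a b c : R).

(** Finiteness is what makes [fine], and hence [len], additive. *)
Lemma bounded_fin_num E a b : measurable E -> E `<=` `[a, b] ->
  (lebesgue_measure E \is a fin_num)%E.
Proof.
move=> mE Eab; rewrite ge0_fin_numE//.
apply: (@le_lt_trans _ _ (lebesgue_measure (`[a, b]%classic : set R))).
  by apply: le_measure; rewrite ?inE//; exact: measurable_itv.
by rewrite lebesgue_measure_itv/=; case: ifP => // _; rewrite -EFinB ltry.
Qed.

Lemma lenU E F a b : measurable E -> measurable F -> E `<=` `[a, b] ->
  F `<=` `[a, b] -> E `&` F = set0 -> len (E `|` F) = len E + len F.
Proof.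
move=> mE mF Eab Fab EF0; rewrite /len measureU// fineD//;
  exact: bounded_fin_num Eab || exact: bounded_fin_num Fab.
Qed.

Lemma len_sub_set1 E a : E `<=` [set a] -> len E = 0.
Proof.
move=> /subset_set1[|] ->; rewrite /len ?measure0//.
by rewrite lebesgue_measure_set1.
Qed.

Lemma len_itv (s1 s2 : bool) a b : a <= b ->
  len [set` Interval (BSide s1 a) (BSide s2 b)] = b - a.
Proof.
move=> ab; rewrite /len lebesgue_measure_itv/= lte_fin.
case: ltP => // ba; have -> : a = b by apply/le_anti; rewrite ab.
by rewrite subrr.
Qed.

(** Only the point [c], of measure zero, is lost. The first interval keeps its right end so that the
    splitting can be iterated along a grid. *)
Lemma len_itv_split E a b c : measurable E -> a <= b -> b < c ->
  len (E `&` `]a, c]) = len (E `&` `]a, b]) + len (E `&` `]b, c[).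
Proof.
move=> mE ab bc.
have mI (i : interval R) : measurable (E `&` [set` i]).
  by apply: measurableI => //; exact: measurable_itv.
have -> : E `&` `]a, c] =
    (E `&` `]a, b] `|` E `&` `]b, c[) `|` (E `&` `[c, c]).
  apply/seteqP; split => y; rewrite /= !in_itv/=.
    move=> [Ey /andP[ay yc]]; have [yb|yb] := leP y b.
      by left; left; rewrite ay.
    have [yc'|yc'] := ltP y c; first by left; right.
    by right; split => //; apply/andP; split.
  move=> [[]|] [Ey /andP[h1 h2]]; split => //; apply/andP; split; lra.
rewrite (@lenU _ _ a c)//; first 1 last.
- by apply: measurableU.
- move=> y [] [_]; rewrite /= !in_itv/= => /andP[h1 h2]; apply/andP; split; lra.
- by move=> y [_]; rewrite /= !in_itv/= => /andP[h1 h2]; apply/andP; split; lra.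
- apply/seteqP; split => // y [[]] [_]; rewrite /= in_itv/= => /andP[h1 h2] [_];
    rewrite /= in_itv/= => /andP[h3 h4]; lra.
rewrite (@lenU _ _ a c)//; first 1 last.
- by move=> y [_]; rewrite /= !in_itv/= => /andP[h1 h2]; apply/andP; split; lra.
- by move=> y [_]; rewrite /= !in_itv/= => /andP[h1 h2]; apply/andP; split; lra.
- apply/seteqP; split => // y [] [_]; rewrite /= in_itv/= => /andP[h1 h2] [_];
    rewrite /= in_itv/= => /andP[h3 h4]; lra.
rewrite (@len_sub_set1 (E `&` `[c, c]) c) ?addr0// => y [_].
by rewrite /= in_itv/= => /andP[h1 h2]; apply/le_anti; rewrite h1 h2.
Qed.

Lemma measurable_piece c S : is_piece c S -> measurable S.
Proof.
move=> [k [I [_ [_ ->]]]]; apply: fin_bigcup_measurable => // i _.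
rewrite (_ : [set x | _] = [set` `[(I i).1, (I i).2]]); first exact: measurable_itv.
by apply/seteqP; split => y /=; rewrite in_itv.
Qed.

Lemma piece_sub c S : is_piece c S -> S `<=` `[0, c].
Proof.
move=> [k [I [h [_ ->]]]] y [i _] /= /andP[h1 h2].
have [a0 [_ bc]] := h i; rewrite in_itv/=; apply/andP; split; lra.
Qed.

(** Take all interval endpoints: an open interval containing none of them lies inside or outside
    each closed interval of the piece. *)
Lemma piece_cuts c S : is_piece c S -> exists e : seq R,
  (forall y, y \in e -> 0 <= y <= c) /\
  forall a b, (forall y, a < y < b -> y \notin e) ->
    forall y z, a < y < b -> a < z < b -> S y -> S z.
Proof.
move=> [k [I [h [_ ->]]]].
exists (codom (fun i => (I i).1) ++ codom (fun i => (I i).2)); split.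
  move=> y; rewrite mem_cat => /orP[] /codomP[i ->]; have [? [? ?]] := h i;
    apply/andP; split; lra.
move=> a b nab y z /andP[ay yb] /andP[az zb] [i _ /= /andP[ly yr]].
have nl : ~~ (a < (I i).1 < b).
  apply/negP => /nab; rewrite mem_cat negb_or => /andP[+ _].
  by rewrite codom_f.
have nr : ~~ (a < (I i).2 < b).
  apply/negP => /nab; rewrite mem_cat negb_or => /andP[_].
  by rewrite codom_f.
exists i => //=; apply/andP; split.
  rewrite leNgt; apply/negP => zl; move/negP: nl; apply; apply/andP; split; lra.
rewrite leNgt; apply/negP => zl; move/negP: nr; apply; apply/andP; split; lra.
Qed.

(** The grid lists 0, [c] and [e] in increasing order without repetition. For [c = 0] it is a single
    point and there are no cells. *)
Lemma grid_avoiding c (e : seq R) : 0 <= c -> (forall y, y \in e -> 0 <= y <= c) ->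
  exists K (x : nat -> R), [/\ x 0%N = 0, x K = c,
    forall k, (k < K)%N -> x k < x k.+1 &
    forall k, (k < K)%N -> forall y, x k < y < x k.+1 -> y \notin e].
Proof.
move=> c0 he; pose s : seq R := sort <=%O (undup (0 :: c :: e)).
have mems (y : R) : (y \in s) = (y \in 0 :: c :: e) by rewrite mem_sort mem_undup.
have ss : sorted <%O s by rewrite sort_lt_sorted undup_uniq.
have sr (y : R) : y \in s -> 0 <= y <= c.
  by rewrite mems !inE => /or3P[/eqP->|/eqP->|/he//]; rewrite lexx c0.
have s0 : (0 < size s)%N.
  by rewrite lt0n size_eq0; apply/eqP => E; have := mems 0; rewrite E !inE eqxx.
have lt_nth i j : (i < j)%N -> (j < size s)%N -> nth 0 s i < nth 0 s j.
  by move=> ij js; apply: (sorted_ltn_nth lt_trans) => //; rewrite inE (ltn_trans ij).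
have le_nth i j : (i <= j)%N -> (j < size s)%N -> nth 0 s i <= nth 0 s j.
  by rewrite leq_eqVlt => /orP[/eqP->//|ij js]; exact/ltW/lt_nth.
have mnth (y : R) : y \in 0 :: c :: e -> exists2 j, (j < size s)%N & nth 0 s j = y.
  by rewrite -mems => /(nthP 0).
exists (size s).-1, (nth 0 s); split.
- have [j js E] : exists2 j, (j < size s)%N & nth 0 s j = 0 by apply: mnth; rewrite !inE eqxx.
  apply/le_anti/andP; split; first by rewrite -[leRHS]E le_nth.
  by have /sr/andP[] : nth 0 s 0 \in s by exact: mem_nth.
- have [j js E] : exists2 j, (j < size s)%N & nth 0 s j = c.
    by apply: mnth; rewrite !inE eqxx orbT.
  apply/le_anti/andP; split; last by rewrite -[leLHS]E le_nth ?prednK// -ltnS prednK.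
  by have /sr/andP[] : nth 0 s (size s).-1 \in s by rewrite mem_nth// prednK.
- by move=> k kK; apply: lt_nth => //; rewrite -ltn_predRL.
move=> k kK y /andP[ky yk]; apply/negP => ye.
have [j js E] : exists2 j, (j < size s)%N & nth 0 s j = y.
  by apply: mnth; rewrite !inE ye !orbT.
have [jk|kj] := leqP j k.
  have : nth 0 s j <= nth 0 s k by apply: le_nth => //; rewrite (ltn_trans kK)// prednK.
  by rewrite E leNgt ky.
by have := le_nth _ _ kj js; rewrite E leNgt yk.
Qed.

(** * Sets that are constant on the open cells of a grid *)

Section Grid.
Variables (K : nat) (x : nat -> R).
Hypothesis x_inc : forall k, (k < K)%N -> x k < x k.+1.

Definition cell_len (k : 'I_K) : R := x k.+1 - x k.
Definition cell_mid (k : 'I_K) : R := (x k + x k.+1) / 2.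
(** Grid points are left unconstrained, since they carry no length; the midpoint then decides for
    the whole open cell. *)
Definition adapted S := forall k, (k < K)%N ->
  forall y z, x k < y < x k.+1 -> x k < z < x k.+1 -> S y -> S z.

Lemma cell_len_ge0 k : 0 <= cell_len k.
Proof. by rewrite subr_ge0 ltW// x_inc. Qed.

Lemma adaptedI S E : adapted S -> adapted E -> adapted (S `&` E).
Proof.
move=> aS aE k kK y z hy hz [Sy Ey].
by split; [exact: (aS _ kK _ _ hy hz Sy)|exact: (aE _ kK _ _ hy hz Ey)].
Qed.

Lemma adapted_mid S (k : 'I_K) y : adapted S -> x k < y < x k.+1 ->
  S y <-> S (cell_mid k).
Proof.
move=> aS hy; have := x_inc (ltn_ord k) => xk.
have hm : x k < cell_mid k < x k.+1 by rewrite /cell_mid; apply/andP; split; lra.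
split; [exact: (aS _ (ltn_ord k))|exact: (aS _ (ltn_ord k))].
Qed.

Lemma grid_le i j : (i <= j)%N -> (j <= K)%N -> x i <= x j.
Proof.
elim: j => [|j IH]; first by rewrite leqn0 => /eqP->.
rewrite leq_eqVlt => /orP[/eqP->//|ij jK].
by rewrite (le_trans (IH _ (ltnW jK)))// ltW// x_inc.
Qed.

Lemma len_cells E : measurable E -> E `<=` `[x 0%N, x K] ->
  len E = \sum_(k < K) len (E `&` `]x k, x k.+1[).
Proof.
move=> mE Esub.
have main j : (j <= K)%N ->
    len (E `&` `]x 0%N, x j]) = \sum_(k < j) len (E `&` `]x k, x k.+1[).
  elim: j => [_|j IH jK].
    by rewrite big_ord0 set_itv_ge ?setI0 /len ?measure0// bnd_simp ltxx.
    rewrite big_ord_recr/= -IH ?(ltnW jK)//; apply: len_itv_split => //.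
      by rewrite grid_le// ltnW.
    exact: x_inc.
rewrite -main// -[LHS]addr0.
(* The half-open intervals of [main] miss the left end of the grid, which has length zero. *)
have -> : len E = len (E `&` `]x 0%N, x K]) + len (E `&` `[x 0%N, x 0%N]).
  rewrite -(@lenU _ _ (x 0%N) (x K)).
  - congr len; apply/seteqP; split => y.
      move=> Ey; have := Esub y Ey; rewrite /= !in_itv/= => /andP[h1 h2].
      have [h|h] := ltP (x 0%N) y; first by left; split => //; rewrite /= in_itv/= h.
      by right; split => //; apply/andP; split.
    by case => -[].
  - by apply: measurableI => //; exact: measurable_itv.
  - by apply: measurableI => //; exact: measurable_itv.
  - by move=> y [/Esub].
  - by move=> y [/Esub].
  - apply/seteqP; split => // y [] [_]; rewrite /= in_itv/= => /andP[h1 h2] [_];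
      rewrite /= in_itv/= => /andP[h3 h4]; lra.
rewrite (@len_sub_set1 (E `&` `[_, _]) (x 0%N)) ?addr0// => y [_].
by rewrite /= in_itv/= => /andP[h1 h2]; apply/le_anti; rewrite h1 h2.
Qed.

Lemma len_adapted S : measurable S -> S `<=` `[x 0%N, x K] -> adapted S ->
  len S = \sum_(k < K | `[< S (cell_mid k) >]) cell_len k.
Proof.
move=> mS Ssub aS; rewrite len_cells// [RHS]big_mkcond/=; apply: eq_bigr => k _.
case: asboolP => Sk.
  rewrite (_ : _ `&` _ = `]x k, x k.+1[%classic) ?len_itv// ?ltW ?x_inc//.
  apply: setIidr => y; rewrite /= in_itv/= => hy.
  exact/(adapted_mid aS hy).
rewrite (_ : _ `&` _ = set0) /len ?measure0//.
apply/seteqP; split => // y []; rewrite /= in_itv/= => Sy hy.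
exact/Sk/(adapted_mid aS hy).
Qed.

(** Each cell is filled from its left end; the position inside a cell is irrelevant for adapted
    sets. A fraction 0 leaves one point, of length zero. *)
Definition partial_cells (phi : 'I_K -> R) : set R :=
  \bigcup_(k in [set: 'I_K])
    [set y | x k <= y <= x k + phi k * cell_len k].

Lemma partial_cell_lt (phi : 'I_K -> R) k : 0 <= phi k < 1 ->
  x k <= x k + phi k * cell_len k /\ x k + phi k * cell_len k < x k.+1.
Proof.
move=> /andP[p0 p1]; have := x_inc (ltn_ord k); rewrite /cell_len => h.
split; nra.
Qed.

(* Fractions below 1 keep the closed subintervals of adjacent cells disjoint. *)
Lemma partial_cells_piece (phi : 'I_K -> R) c : x 0%N = 0 -> x K = c ->
  (forall k, 0 <= phi k < 1) -> is_piece c (partial_cells phi).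
Proof.
move=> x0 xK phi01.
exists K, (fun k : 'I_K => (x k, x k + phi k * cell_len k)); split; last split => //=.
  move=> k /=; have [h1 h2] := partial_cell_lt (phi01 k).
  split; first by rewrite -x0 grid_le// ltnW.
  by split => //; rewrite (le_trans (ltW h2))// -xK grid_le.
suff lt_disj (i j : 'I_K) : (i < j)%N ->
    [set y | x i <= y <= x i + phi i * cell_len i] `&`
    [set y | x j <= y <= x j + phi j * cell_len j] = set0.
  move=> i j; rewrite -val_eqE/= neq_ltn => /orP[|] ij; first exact: lt_disj.
  by rewrite setIC; exact: lt_disj.
move=> ij; apply/seteqP; split => // y [] /= /andP[_ yi] /andP[jy _].
have [_ h] := partial_cell_lt (phi01 i).
have := grid_le ij (ltnW (ltn_ord j)); lra.
Qed.

Lemma len_partial_cells S (phi : 'I_K -> R) : measurable S -> adapted S ->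
  (forall k, 0 <= phi k < 1) ->
  len (S `&` partial_cells phi) =
  \sum_(k < K | `[< S (cell_mid k) >]) phi k * cell_len k.
Proof.
move=> mS aS phi01.
rewrite len_cells.
- rewrite [RHS]big_mkcond/=; apply: eq_bigr => k _.
  have [hk1 hk2] := partial_cell_lt (phi01 k).
  (* No other interval meets the open cell [k]: those to the left end before [x k], those to the
     right start at [x k.+1] or later. *)
  have B y : x k < y < x k.+1 -> partial_cells phi y <-> y <= x k + phi k * cell_len k.
    move=> /andP[y1 y2]; split; last by move=> h; exists k => //=; rewrite h ltW.
    move=> [j _ /= /andP[jy yj]].
    have [jk|kj|/val_inj jk] := ltngtP j k; last by rewrite -jk.
      have [_ h] := partial_cell_lt (phi01 j).
      have := grid_le jk (ltnW (ltn_ord k)); lra.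
    have := grid_le kj (ltnW (ltn_ord j)); lra.
  case: asboolP => Sk.
    rewrite (_ : _ `&` _ = `]x k, x k + phi k * cell_len k]%classic).
      by rewrite len_itv// addrC addKr.
    apply/seteqP; split => y /=; rewrite !in_itv/=.
      by move=> [[Sy By] hy]; case/andP: (hy) => -> _ /=; exact/(B _ hy).
    move=> /andP[h1 h2].
    have hy : x k < y < x k.+1 by rewrite h1 (le_lt_trans h2).
    by split => //; split; [exact/(adapted_mid aS hy)|exact/(B _ hy)].
  rewrite (_ : _ `&` _ = set0) /len ?measure0//.
  apply/seteqP; split => // y [] [Sy _]; rewrite /= in_itv/= => hy.
  exact/Sk/(adapted_mid aS hy).
- apply: measurableI => //; apply: fin_bigcup_measurable => // k _.
  rewrite (_ : [set y | _] = [set` `[x k, x k + phi k * cell_len k]]).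
    exact: measurable_itv.
  by apply/seteqP; split => y /=; rewrite in_itv.
- move=> y [_ [k _ /= /andP[h1 h2]]]; rewrite in_itv/=.
  have [_ h3] := partial_cell_lt (phi01 k).
  have h4 := grid_le (leq0n k) (ltnW (ltn_ord k)).
  have h5 := grid_le (ltn_ord k) (leqnn K).
  apply/andP; split; lra.
Qed.

End Grid.

Lemma common_grid c (I : finType) (P : I -> set R) : 0 <= c ->
  (forall i, is_piece c (P i)) ->
  exists K (x : nat -> R), [/\ x 0%N = 0, x K = c,
    forall k, (k < K)%N -> x k < x k.+1 &
    forall i, adapted K x (P i)].
Proof.
move=> c0 pP; have /choice[e he] := fun i => piece_cuts (pP i).
have [|K [x [x0 xK xinc xe]]] := @grid_avoiding c (flatten (codom e)) c0.
  move=> y /flattenP[s /codomP[i ->]]; exact: (he i).1.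
exists K, x; split => // i k kK; apply: (he i).2 => y hy.
apply/negP => ye; have /negP := xe k kK y hy; apply.
by apply/flattenP; exists (e i) => //; exact: codom_f.
Qed.

End Length.

(** * Translation of the instance into cells *)

Theorem mainTheorem11 (R : realType) (n m : nat) (c alpha : R)
  (RA : 'I_n -> bundle R m) (A : bundle R m) :
  (0 < n)%N ->
  0 <= c ->
  (0 < c \/ (0 < m)%N) ->
  0 < alpha -> alpha <= c + m%:R ->
  (forall i, is_bundle c (RA i)) ->
  is_GPAV c alpha RA A ->
  EJR1 alpha RA A.
Proof.
move=> n0 c0 _ al0 _ bRA [[bA sA] optA] t t0 Ns [coh tle].
(* [None] stands for the allocation, so that one grid is adapted to it and to all approved
   pieces. *)
pose P (o : option 'I_n) := if o is Some i then (RA i).1 else A.1.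
have [|K [x [x0 xK xinc adP]]] := @common_grid R c (option 'I_n) P c0.
  by case.
have adA : adapted K x A.1 := adP None.
have adRA i : adapted K x (RA i).1 := adP (Some i).
have mA := measurable_piece bA; have mRA i := measurable_piece (bRA i).
have subA : A.1 `<=` `[x 0%N, x K] by rewrite x0 xK; exact: piece_sub bA.
have subRA i : (RA i).1 `<=` `[x 0%N, x K] by rewrite x0 xK; exact: piece_sub (bRA i).
pose d := @cell_len R K x.
have d0 k : 0 <= d k by exact: cell_len_ge0.
pose inside (S : set R) : pred 'I_K := fun k => `[< S (cell_mid x k) >].
pose chi i := inside (RA i).1.
pose G i := (RA i).2.
pose T := group_inter RA Ns.
have sizeE (S : set R) (X : {set 'I_m}) : measurable S -> S `<=` `[x 0%N, x K] ->
    adapted K x S -> bsize (S, X) = frac_size d (fun k => (inside S k)%:R) X.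
  move=> mS subS adS; rewrite /bsize /frac_size /cake_size/= (len_adapted xinc)//.
  congr (_ + _); rewrite big_mkcond/=; apply: eq_bigr => k _; rewrite /inside.
  by case: asboolP; rewrite ?mul1r ?mul0r.
have utilE i : util (RA i) A = frac_util d chi G (fun k => (inside A.1 k)%:R) A.2 i.
  rewrite /util /frac_util /cake_util (len_adapted xinc).
  - congr (_ + _); rewrite big_mkcond [RHS]big_mkcond/=; apply: eq_bigr => k _.
    rewrite /chi /inside asbool_and.
    by case: asboolP; case: asboolP; rewrite ?mul1r ?mul0r.
  - exact: measurableI.
  - by move=> y [/subRA].
  - exact: adaptedI.
(* A member is needed to bound the common cake: an empty intersection would be the whole line. *)
have Ns0 : exists j, j \in Ns.
  apply/finset.set0Pn; rewrite -card_gt0 -(ltr0n R) (lt_le_trans _ coh)//.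
  by rewrite divr_gt0// mulr_gt0// ltr0n.
have [j0 j0N] := Ns0.
suff [j jN tj] : exists2 j, j \in Ns &
    t - 1 < frac_util d chi G (fun k => (inside A.1 k)%:R) A.2 j.
  by exists j; rewrite // utilE.
apply: (@frac_EJR1 R n m K d chi G d0 alpha t _ _ (inside T.1) T.2) => //.
- by rewrite -sizeE// -surjective_pairing.
- move=> phi X phi01 szle.
  pose B : bundle R m := (partial_cells x phi, X).
  have utilB i : util (RA i) B = frac_util d chi G phi X i.
    by rewrite /util (len_partial_cells xinc).
  have /optA : is_allocation c alpha B.
    split; first exact: partial_cells_piece.
    (* The whole line is an adapted set, so the formula for intersections also yields the length of
       the piece itself. *)
    rewrite /bsize/= -[partial_cells x phi]setTI (len_partial_cells xinc)//.
    apply: le_trans szle; rewrite lerD2r /cake_size big_mkcond/=.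
    by apply: ler_sum => k _; case: asboolP => // -[].
  suff -> : gpav_score RA B = frac_score d chi G phi X.
    suff -> : gpav_score RA A = frac_score d chi G (fun k => (inside A.1 k)%:R) A.2 by [].
    by apply: eq_bigr => i _; rewrite utilE.
  by apply: eq_bigr => i _; rewrite utilB.
- by move=> i k iN /asboolP Tk; apply/asboolP; exact: Tk.
- by move=> i iN; exact: finset.bigcap_inf.
- apply: (le_trans tle); rewrite -sizeE -?surjective_pairing//.
  + by apply: fin_bigcap_measurable.
  + by move=> y /(_ j0 j0N)/subRA.
  + by move=> k kK y z hy hz Ty i iN; exact: (adRA i _ kK _ _ hy hz (Ty i iN)).
Qed.
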